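(* Let $I,J\subset\mathbb{R}$ be open intervals with $0\in J$, and let $\alpha: I\times J\to E_1^3$, $(s,t)\mapsto\alpha(s,t)$, be a smooth solution of the vortex filament equation $\alpha_t=\alpha_s\times_L\alpha_{ss}$ such that each curve $\alpha(\cdot,t)$ is a spacelike curve with timelike binormal and $\|\alpha_s(s,0)\|=1$ for all $s$. Then: (1) There exists a parallel normal frame $(T,E_1,E_2)^T(\cdot,t)$, $T=\alpha_s$, for each spacelike curve $\alpha(\cdot,t)$ with timelike binormal (depending smoothly on $(s,t)$) such that $$\begin{bmatrix} T \\ E_1 \\ E_2 \end{bmatrix}_s=\begin{bmatrix} 0&k_1&k_2 \\ -k_1&0&0 \\ k_2&0&0 \end{bmatrix}\begin{bmatrix} T \\ E_1 \\ E_2 \end{bmatrix},$$ $$\begin{bmatrix} T \\ E_1 \\ E_2 \end{bmatrix}_t=\begin{bmatrix} 0&(k_2)_s&(k_1)_s \\ -(k_2)_s&0&-\frac12(k_1^2-k_2^2) \\ (k_1)_s&-\frac12(k_1^2-k_2^2)&0 \end{bmatrix}\begin{bmatrix} T \\ E_1 \\ E_2 \end{bmatrix},$$ where $k_1(\cdot,t)$ and $k_2(\cdot,t)$ are the principal curvatures of $\alpha(\cdot,t)$ along $E_1(\cdot,t)$ and $E_2(\cdot,t)$, respectively. (2) With $k_1,k_2$ as in (1), the pair $$q=\frac{1}{\sqrt2}(k_1+k_2),\qquad r=\frac{1}{\sqrt2}(k_1-k_2)$$ is a solution of the non-linear heat system $$q_t=q_{ss}+q^2r,\qquad r_t=-r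_{ss}-r^2q.$$
   Context: Minkowski 3-space $E_1^3$ is $\mathbb{R}^3$ with the Lorentzian inner product $\langle x,y\rangle_L=-x_1y_1+x_2y_2+x_3y_3$. The norm is $\|x\|=\sqrt{|\langle x,x\rangle_L|}$. The Lorentzian vector product is $x\times_L y=(-x_2y_3+x_3y_2,\;x_3y_1-x_1y_3,\;x_1y_2-x_2y_1)$. A vector $x$ is spacelike, lightlike or timelike if $\langle x,x\rangle_L$ is $>0$, $=0$, $<0$ respectively; a curve is spacelike if all of its tangent vectors are spacelike. Subscripts $s$ and $t$ denote partial derivatives. For a solution of the vortex filament equation with $\|\alpha_s(s,0)\|=1$ for all $s$, one has $\|\alpha_s(s,t)\|=1$ for all $(s,t)$ (known fact), so $s$ is an arclength parameter for each $\alpha(\cdot,t)$ and $T=\alpha_s$ is the unit tangent. The principal normal $N$ is the unit vector field with $T_s=\kappa N$, $\kappa$ being the curvature, and the binormal is $B=T\times_L N$; ''timelike binormal'' means $\langle N,N\rangle_L=1$ and $\langle B,B\rangle_L=-1$ (so $T_s$ is everywhere spacelike). A parallel (normal) frame of a unit speed spacelike curve with timelike binormal and unit tangent $T$ is an orthonormal frame $(T,E_1,E_2)$ along the curve with $\langle T,T\rangle_L=1$, $\langle E_1,E_1\rangle_L=1$, $\langle E_2,E_2\rangle_L=-1$, all mutual products zero, and $\langle (E_1)_s,E_2\rangle_L=\langle E_1,(E_2)_s\rangle_L=0$. The principal curvatures $k_1,k_2$ of the curve along $E_1,E_2$ are the coefficients in $T_s=k_1E_1+k_2E_2$. *)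

(* Defs.v *)
From Stdlib Require Import Reals.
From Coquelicot Require Import Coquelicot.
Open Scope R_scope.

(* Minkowski 3-space, with its vector space structure [plus], [scal] taken from
   Coquelicot's product of normed modules. *)
Notation E13 := (R * R * R)%type.

Definition x1 (x : E13) : R := fst (fst x).
Definition x2 (x : E13) : R := snd (fst x).
Definition x3 (x : E13) : R := snd x.

Definition ldot (x y : E13) : R := - (x1 x * x1 y) + x2 x * x2 y + x3 x * x3 y.

Definition lnorm (x : E13) : R := sqrt (Rabs (ldot x x)).

Definition lcross (x y : E13) : E13 :=
  (- (x2 x * x3 y) + x3 x * x2 y,
   x3 x * x1 y - x1 x * x3 y,
   x1 x * x2 y - x2 x * x1 y).

Definition lincomb (a : R) (x : E13) (b : R) (y : E13) : E13 :=
  plus (scal a x) (scal b y).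

(* Any nonempty open interval has the form ]a, b[ with a < b in the extended
   reals. *)
Definition in_oint (a b : Rbar) (x : R) : Prop := Rbar_lt a x /\ Rbar_lt x b.

Definition vderive (c : R -> E13) (s : R) : E13 :=
  (Derive (fun x => x1 (c x)) s,
   Derive (fun x => x2 (c x)) s,
   Derive (fun x => x3 (c x)) s).

Definition ds (f : R -> R -> R) (s t : R) : R := Derive (fun x => f x t) s.
Definition dt (f : R -> R -> R) (s t : R) : R := Derive (fun y => f s y) t.
Definition vds (F : R -> R -> E13) (s t : R) : E13 := vderive (fun x => F x t) s.
Definition vdt (F : R -> R -> E13) (s t : R) : E13 := vderive (fun y => F s y) t.

(* [ex_diff_n f n] says that all iterated partial derivatives of f up to order n
   exist and are continuous; U and V are meant to be open, so that [smooth] is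
   C^infinity on U x V whatever the values of f outside. *)
Definition smooth (U V : R -> Prop) (f : R -> R -> R) : Prop :=
  forall (n : nat) (s t : R), U s -> V t -> ex_diff_n f n s t.

Definition vsmooth (U V : R -> Prop) (F : R -> R -> E13) : Prop :=
  smooth U V (fun s t => x1 (F s t)) /\
  smooth U V (fun s t => x2 (F s t)) /\
  smooth U V (fun s t => x3 (F s t)).

Definition spacelike_curve (U : R -> Prop) (c : R -> E13) : Prop :=
  forall s, U s -> 0 < ldot (vderive c s) (vderive c s).

(* Frenet apparatus of a curve parametrized by arclength. *)
Definition tangent (c : R -> E13) (s : R) : E13 := vderive c s.
Definition curvature (c : R -> E13) (s : R) : R := lnorm (vderive (tangent c) s).
Definition principal_normal (c : R -> E13) (s : R) : E13 :=
  scal (/ curvature c s) (vderive (tangent c) s).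
Definition binormal (c : R -> E13) (s : R) : E13 :=
  lcross (tangent c s) (principal_normal c s).

(* If T_s is lightlike or zero, [principal_normal] is a multiple of T_s, so the
   first equation fails: the condition forces T_s to be spacelike. *)
Definition timelike_binormal (U : R -> Prop) (c : R -> E13) : Prop :=
  forall s, U s ->
    ldot (principal_normal c s) (principal_normal c s) = 1 /\
    ldot (binormal c s) (binormal c s) = -1.

Definition vortex_filament (U V : R -> Prop) (alpha : R -> R -> E13) : Prop :=
  forall s t, U s -> V t ->
    vdt alpha s t = lcross (vds alpha s t) (vds (vds alpha) s t).

Definition parallel_frame (U : R -> Prop) (c E1 E2 : R -> E13) : Prop :=
  forall s, U s ->
    ldot (tangent c s) (tangent c s) = 1 /\
    ldot (E1 s) (E1 s) = 1 /\
    ldot (E2 s) (E2 s) = -1 /\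
    ldot (tangent c s) (E1 s) = 0 /\
    ldot (tangent c s) (E2 s) = 0 /\
    ldot (E1 s) (E2 s) = 0 /\
    ldot (vderive E1 s) (E2 s) = 0 /\
    ldot (E1 s) (vderive E2 s) = 0.

Definition principal_curvatures (U : R -> Prop) (c E1 E2 : R -> E13)
    (k1 k2 : R -> R) : Prop :=
  forall s, U s ->
    vderive (tangent c) s = lincomb (k1 s) (E1 s) (k2 s) (E2 s).

Definition frame_system_s (U V : R -> Prop) (T E1 E2 : R -> R -> E13)
    (k1 k2 : R -> R -> R) : Prop :=
  forall s t, U s -> V t ->
    vds T s t = lincomb (k1 s t) (E1 s t) (k2 s t) (E2 s t) /\
    vds E1 s t = scal (- k1 s t) (T s t) /\
    vds E2 s t = scal (k2 s t) (T s t).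

Definition frame_system_t (U V : R -> Prop) (T E1 E2 : R -> R -> E13)
    (k1 k2 : R -> R -> R) : Prop :=
  forall s t, U s -> V t ->
    vdt T s t = lincomb (ds k2 s t) (E1 s t) (ds k1 s t) (E2 s t) /\
    vdt E1 s t =
      lincomb (- ds k2 s t) (T s t)
              (- (1 / 2) * (k1 s t ^ 2 - k2 s t ^ 2)) (E2 s t) /\
    vdt E2 s t =
      lincomb (ds k1 s t) (T s t)
              (- (1 / 2) * (k1 s t ^ 2 - k2 s t ^ 2)) (E1 s t).

Definition evolving_parallel_frame (U V : R -> Prop) (alpha E1 E2 : R -> R -> E13)
    (k1 k2 : R -> R -> R) : Prop :=
  vsmooth U V E1 /\ vsmooth U V E2 /\ smooth U V k1 /\ smooth U V k2 /\
  (forall t, V t ->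
     parallel_frame U (fun s => alpha s t) (fun s => E1 s t) (fun s => E2 s t) /\
     principal_curvatures U (fun s => alpha s t)
       (fun s => E1 s t) (fun s => E2 s t) (fun s => k1 s t) (fun s => k2 s t)) /\
  frame_system_s U V (vds alpha) E1 E2 k1 k2 /\
  frame_system_t U V (vds alpha) E1 E2 k1 k2.

Definition nonlinear_heat_system (U V : R -> Prop) (q r : R -> R -> R) : Prop :=
  smooth U V q /\ smooth U V r /\
  (forall s t, U s -> V t ->
     dt q s t = ds (ds q) s t + q s t ^ 2 * r s t /\
     dt r s t = - ds (ds r) s t - r s t ^ 2 * q s t).

(* Main.v *)
Require Import Defs.
From Stdlib Require Import Reals Lra.
From Coquelicot Require Import Coquelicot.
Open Scope R_scope.

(** Write [x] for the Lorentzian vector product, [<,>] for the Lorentzian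
    product, [T = alpha_s] and [K = T_s].  Differentiating the vortex filament
    equation along the curves gives [T_t = T x K_s] ([tangent_flow]).  Hence
    [<T,T>] does not depend on time and is [1] everywhere ([unit_tangent]), and
    [K] is orthogonal to [T]; the timelike binormal makes [K] spacelike
    ([curvature_pos]), so that [N = K / |K|] is a smooth unit normal field.

    Existence of the frame.  Let [B = T x N].  The plane spanned by [N] and [B]
    is Lorentzian, and all the normal frames with the same orientations arise
    from [(N,B)] by a hyperbolic rotation of some angle [th]:
    [E1 = cosh th N + sinh th B] and [E2 = T x E1].  The rotation lowers the
    rotation speed of the frame, in either variable, by the derivative of [th]
    ([rotation_speed_hrot]): [<E1',E2> = <N',B> - th'].  The required frame
    therefore exists if and only if the equations
      [th_s = <N_s,B>]   and   [th_t = <N_t,B> - <K,K> / 2]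
    have a common solution; the first one makes the frame parallel, the second
    one fixes the rotation that remains free at each time.  On a rectangle, the
    solution exists because this form is closed ([rotation_form_closed]):
    expanding the derivatives of [N] and [B] in the basis [T, N, B],
      [<N_s,B>_t - <N_t,B>_s = <N_s,B_t> - <N_t,B_s>
         = <K,N><T_t,B> - <T_t,N><K,B> = - <K,N><K_s,N> + <K,B><K_s,B>
         = - <K,K_s>],
    where the flow enters through [<T_t,B> = - <K_s,N>] and
    [<T_t,N> = - <K_s,B>].  With [k1 = <K,E1>] and [k2 = - <K,E2>] one has
    [<K,K> = k1^2 - k2^2], and since [(E1)_s] and [(E2)_s] are multiples of [T],
    the derivatives of [k1] and [k2] along the curve are the components of
    [K_s], which turns the flow into the stated evolution
    ([frame_systems_of_rotation_speed]).

    The heat system.  For any frame satisfying both linear systems, the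
    [T]-components of the mixed derivatives of [E1] and of [E2], computed in
    either order, agree; this gives
      [(k1)_t = (k2)_ss + (k1^2 - k2^2) k2 / 2],
      [(k2)_t = (k1)_ss + (k1^2 - k2^2) k1 / 2]
    ([frame_compatibility]).  As [q r = (k1^2 - k2^2) / 2], the sum and the
    difference of these equations are the system for [q] and [r].

    Smoothness is closed under the operations involved; for the primitive [th],
    the exponential and the inverse square root it comes from
    [smooth_bootstrap]. *)

(** * Smooth functions on a product of open sets *)

Lemma is_derive_Rmult (f g : R -> R) x df dg :
  is_derive f x df -> is_derive g x dg ->
  is_derive (fun y => f y * g y) x (df * g x + f x * dg).
Proof.
  intros Hf Hg. apply @is_derive_mult; auto. intros; apply Rmult_comm.
Qed.

Section Smoothness.

Context (U V : R -> Prop) (openU : open U) (openV : open V).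

Definition differentiable_to (n : nat) (f : R -> R -> R) : Prop :=
  forall s t, U s -> V t -> ex_diff_n f n s t.

Lemma locally_2d_product (P : R -> R -> Prop) (s t : R) :
  (forall u v, U u -> V v -> P u v) -> U s -> V t -> locally_2d P s t.
Proof.
  intros HP Us Vt.
  destruct (openU s Us) as [e1 H1]. destruct (openV t Vt) as [e2 H2].
  assert (He : 0 < Rmin e1 e2) by (apply Rmin_pos; apply cond_pos).
  exists (mkposreal _ He). intros u v Hu Hv. simpl in Hu, Hv.
  apply HP; [apply H1 | apply H2].
  - exact (Rlt_le_trans _ _ _ Hu (Rmin_l _ _)).
  - exact (Rlt_le_trans _ _ _ Hv (Rmin_r _ _)).
Qed.

Lemma differentiable_to_ext n f g :
  (forall s t, U s -> V t -> f s t = g s t) ->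
  differentiable_to n f -> differentiable_to n g.
Proof.
  intros E Hf s t Us Vt. apply ex_diff_n_ext_loc with (2 := Hf s t Us Vt).
  now apply locally_2d_product.
Qed.

Lemma smooth_ext f g :
  (forall s t, U s -> V t -> f s t = g s t) -> smooth U V f -> smooth U V g.
Proof. intros E Hf n. exact (differentiable_to_ext n f g E (Hf n)). Qed.

Lemma differentiable_to_S n f A B :
  (forall s t, U s -> V t -> continuity_2d_pt f s t) ->
  (forall s t, U s -> V t -> is_derive (fun x => f x t) s (A s t)) ->
  (forall s t, U s -> V t -> is_derive (fun y => f s y) t (B s t)) ->
  differentiable_to n A -> differentiable_to n B ->
  differentiable_to (S n) f.
Proof.
  intros Cf HA HB DA DB s t Us Vt. split; [now apply Cf |].
  split; [now exists (A s t); apply HA |].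
  split; [now exists (B s t); apply HB |].
  split.
  - apply (differentiable_to_ext n A); auto.
    intros u v Uu Vv. symmetry. now apply is_derive_unique, HA.
  - apply (differentiable_to_ext n B); auto.
    intros u v Uu Vv. symmetry. now apply is_derive_unique, HB.
Qed.

Lemma differentiable_to_le n m f :
  (m <= n)%nat -> differentiable_to n f -> differentiable_to m f.
Proof. intros Hnm Hf s t Us Vt. apply ex_diff_n_m with n; auto. Qed.

Lemma differentiable_to_continuous n f s t :
  differentiable_to n f -> U s -> V t -> continuity_2d_pt f s t.
Proof. intros Hf Us Vt. specialize (Hf s t Us Vt). destruct n; apply Hf. Qed.

Lemma differentiable_to_is_ds n f s t :
  differentiable_to (S n) f -> U s -> V t ->
  is_derive (fun x => f x t) s (ds f s t).
Proof. intros Hf Us Vt. apply Derive_correct, (Hf s t Us Vt). Qed.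

Lemma differentiable_to_is_dt n f s t :
  differentiable_to (S n) f -> U s -> V t ->
  is_derive (fun y => f s y) t (dt f s t).
Proof. intros Hf Us Vt. apply Derive_correct, (Hf s t Us Vt). Qed.

Lemma differentiable_to_ds n f :
  differentiable_to (S n) f -> differentiable_to n (ds f).
Proof. intros Hf s t Us Vt. apply (Hf s t Us Vt). Qed.

Lemma differentiable_to_dt n f :
  differentiable_to (S n) f -> differentiable_to n (dt f).
Proof. intros Hf s t Us Vt. apply (Hf s t Us Vt). Qed.

Lemma differentiable_to_const n c : differentiable_to n (fun _ _ => c).
Proof.
  revert c. induction n as [| n IH]; intros c.
  - intros s t _ _. split; [apply continuity_2d_pt_const | exact I].
  - apply (differentiable_to_S n _ (fun _ _ => 0) (fun _ _ => 0)); auto.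
    + intros. apply continuity_2d_pt_const.
    + intros s t _ _. apply @is_derive_const.
    + intros s t _ _. apply @is_derive_const.
Qed.

Lemma differentiable_to_plus n f g :
  differentiable_to n f -> differentiable_to n g ->
  differentiable_to n (fun s t => f s t + g s t).
Proof.
  revert f g. induction n as [| n IH]; intros f g Hf Hg.
  - intros s t Us Vt.
    split; [apply continuity_2d_pt_plus; [apply Hf | apply Hg] | exact I]; auto.
  - apply (differentiable_to_S n _ (fun s t => ds f s t + ds g s t)
             (fun s t => dt f s t + dt g s t)).
    + intros s t Us Vt. apply continuity_2d_pt_plus;
      eapply differentiable_to_continuous; eauto.
    + intros s t Us Vt.
      apply @is_derive_plus; eapply differentiable_to_is_ds; eauto.
    + intros s t Us Vt.
      apply @is_derive_plus; eapply differentiable_to_is_dt; eauto.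
    + apply IH; now apply differentiable_to_ds.
    + apply IH; now apply differentiable_to_dt.
Qed.

Lemma differentiable_to_mult n f g :
  differentiable_to n f -> differentiable_to n g ->
  differentiable_to n (fun s t => f s t * g s t).
Proof.
  revert f g. induction n as [| n IH]; intros f g Hf Hg.
  - intros s t Us Vt.
    split; [apply continuity_2d_pt_mult; [apply Hf | apply Hg] | exact I]; auto.
  - assert (Hfn : differentiable_to n f) by (apply differentiable_to_le with (S n); auto).
    assert (Hgn : differentiable_to n g) by (apply differentiable_to_le with (S n); auto).
    apply (differentiable_to_S n _ (fun s t => ds f s t * g s t + f s t * ds g s t)
             (fun s t => dt f s t * g s t + f s t * dt g s t)).
    + intros s t Us Vt. apply continuity_2d_pt_mult;
      eapply differentiable_to_continuous; eauto.
    + intros s t Us Vt. apply (is_derive_Rmult (fun x => f x t) (fun x => g x t));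
      eapply differentiable_to_is_ds; eauto.
    + intros s t Us Vt. apply (is_derive_Rmult (fun y => f s y) (fun y => g s y));
      eapply differentiable_to_is_dt; eauto.
    + apply (differentiable_to_plus n (fun s t => ds f s t * g s t)
        (fun s t => f s t * ds g s t)); apply IH; auto using differentiable_to_ds.
    + apply (differentiable_to_plus n (fun s t => dt f s t * g s t)
        (fun s t => f s t * dt g s t)); apply IH; auto using differentiable_to_dt.
Qed.

Lemma smooth_const c : smooth U V (fun _ _ => c).
Proof. intros n. exact (differentiable_to_const n c). Qed.

Lemma smooth_plus f g :
  smooth U V f -> smooth U V g -> smooth U V (fun s t => f s t + g s t).
Proof. intros Hf Hg n. exact (differentiable_to_plus n f g (Hf n) (Hg n)). Qed.

Lemma smooth_mult f g :
  smooth U V f -> smooth U V g -> smooth U V (fun s t => f s t * g s t).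
Proof. intros Hf Hg n. exact (differentiable_to_mult n f g (Hf n) (Hg n)). Qed.

Lemma smooth_opp f : smooth U V f -> smooth U V (fun s t => - f s t).
Proof.
  intros Hf. apply (smooth_ext (fun s t => -1 * f s t)).
  - intros; ring.
  - apply smooth_mult; auto using smooth_const.
Qed.

Lemma smooth_minus f g :
  smooth U V f -> smooth U V g -> smooth U V (fun s t => f s t - g s t).
Proof. intros Hf Hg. apply smooth_plus; auto using smooth_opp. Qed.

Lemma smooth_ds f : smooth U V f -> smooth U V (ds f).
Proof. intros Hf n. exact (differentiable_to_ds n f (Hf (S n))). Qed.

Lemma smooth_dt f : smooth U V f -> smooth U V (dt f).
Proof. intros Hf n. exact (differentiable_to_dt n f (Hf (S n))). Qed.

Lemma smooth_continuous f s t :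
  smooth U V f -> U s -> V t -> continuity_2d_pt f s t.
Proof. intros Hf. exact (differentiable_to_continuous 0 f s t (Hf 0%nat)). Qed.

Lemma smooth_is_ds f s t :
  smooth U V f -> U s -> V t -> is_derive (fun x => f x t) s (ds f s t).
Proof. intros Hf. exact (differentiable_to_is_ds 0 f s t (Hf 1%nat)). Qed.

Lemma smooth_is_dt f s t :
  smooth U V f -> U s -> V t -> is_derive (fun y => f s y) t (dt f s t).
Proof. intros Hf. exact (differentiable_to_is_dt 0 f s t (Hf 1%nat)). Qed.

Lemma smooth_ex_ds f s t :
  smooth U V f -> U s -> V t -> ex_derive (fun x => f x t) s.
Proof. intros Hf Us Vt. exists (ds f s t). now apply smooth_is_ds. Qed.

Lemma smooth_ex_dt f s t :
  smooth U V f -> U s -> V t -> ex_derive (fun y => f s y) t.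
Proof. intros Hf Us Vt. exists (dt f s t). now apply smooth_is_dt. Qed.

(** Bootstrapping: when the partial derivatives of [f] are expressed through
    [f] itself by an operation that loses no regularity, each order of
    differentiability of [f] yields the next one.  This is how functions
    defined by a differential equation (exponentials, powers, primitives) are
    shown to be smooth. *)
Lemma smooth_bootstrap f A B :
  (forall s t, U s -> V t -> continuity_2d_pt f s t) ->
  (forall s t, U s -> V t -> is_derive (fun x => f x t) s (A s t)) ->
  (forall s t, U s -> V t -> is_derive (fun y => f s y) t (B s t)) ->
  (forall n, differentiable_to n f ->
     differentiable_to n A /\ differentiable_to n B) ->
  smooth U V f.
Proof.
  intros Cf HA HB step n. change (differentiable_to n f). induction n as [| n IH].
  - intros s t Us Vt. split; auto; exact I.
  - destruct (step n IH) as [DA DB]. now apply (differentiable_to_S n f A B).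
Qed.

(** The functions [g] meant here solve an autonomous differential equation
    [g' = h o g] on the range of [f]: the partial derivatives of [g o f] are then
    those of [f] times [h] applied to [g o f] itself, and bootstrapping applies. *)
Lemma smooth_comp_autonomous (g h : R -> R) f :
  smooth U V f ->
  (forall s t, U s -> V t -> is_derive g (f s t) (h (g (f s t)))) ->
  (forall n w, differentiable_to n w ->
     differentiable_to n (fun s t => h (w s t))) ->
  smooth U V (fun s t => g (f s t)).
Proof.
  intros Hf Hg Hh.
  apply (smooth_bootstrap _ (fun s t => ds f s t * h (g (f s t)))
           (fun s t => dt f s t * h (g (f s t)))).
  - intros s t Us Vt. apply (continuity_1d_2d_pt_comp g).
    + apply continuity_pt_filterlim.
      apply (ex_derive_continuous (V := R_NormedModule)). exists (h (g (f s t))). now apply Hg.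
    + now apply smooth_continuous.
  - intros s t Us Vt. apply (is_derive_comp g (fun x => f x t)).
    + now apply Hg.
    + now apply smooth_is_ds.
  - intros s t Us Vt. apply (is_derive_comp g (fun y => f s y)).
    + now apply Hg.
    + now apply smooth_is_dt.
  - intros n Hn. split; apply differentiable_to_mult.
    + exact (smooth_ds f Hf n).
    + exact (Hh n _ Hn).
    + exact (smooth_dt f Hf n).
    + exact (Hh n _ Hn).
Qed.

Lemma smooth_exp f : smooth U V f -> smooth U V (fun s t => exp (f s t)).
Proof.
  intros Hf. apply (smooth_comp_autonomous exp (fun y => y)); auto.
  intros; apply is_derive_exp.
Qed.

Lemma smooth_cosh f : smooth U V f -> smooth U V (fun s t => cosh (f s t)).
Proof.
  intros Hf. unfold cosh, Rdiv.
  apply smooth_mult; [apply smooth_plus | apply smooth_const];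
    auto using smooth_exp, smooth_opp.
Qed.

Lemma smooth_sinh f : smooth U V f -> smooth U V (fun s t => sinh (f s t)).
Proof.
  intros Hf. unfold sinh, Rdiv.
  apply smooth_mult; [apply smooth_minus | apply smooth_const];
    auto using smooth_exp, smooth_opp.
Qed.

Lemma smooth_inv_sqrt f :
  (forall s t, U s -> V t -> 0 < f s t) ->
  smooth U V f -> smooth U V (fun s t => / sqrt (f s t)).
Proof.
  intros pos Hf.
  (* y^(-1/2) has the derivative -1/2 (y^(-1/2))^3 *)
  apply (smooth_comp_autonomous (fun y => / sqrt y) (fun y => -(1/2) * (y * (y * y)))).
  - exact Hf.
  - intros s t Us Vt. specialize (pos s t Us Vt). revert pos.
    generalize (f s t). intros y pos. assert (Hy := sqrt_lt_R0 y pos).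
    auto_derive.
    + repeat split; lra.
    + field. lra.
  - intros n w Hw. repeat apply differentiable_to_mult; auto using differentiable_to_const.
Qed.

Lemma smooth_schwarz f s t :
  smooth U V f -> U s -> V t -> dt (ds f) s t = ds (dt f) s t.
Proof.
  intros Hf Us Vt. symmetry. apply (Schwarz f s t).
  - apply locally_2d_product; auto. intros u v Uu Vv. repeat split.
    + now apply smooth_ex_ds.
    + now apply smooth_ex_dt.
    + apply (smooth_ex_ds (dt f)); auto. now apply smooth_dt.
    + apply (smooth_ex_dt (ds f)); auto. now apply smooth_ds.
  - apply (smooth_continuous (ds (dt f))); auto. now apply smooth_ds, smooth_dt.
  - apply (smooth_continuous (dt (ds f))); auto. now apply smooth_dt, smooth_ds.
Qed.

(** Existence of the partial derivatives alone would not give joint continuity;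
    continuity of one of them makes [f] differentiable. *)
Lemma continuity_of_partials f A B s t :
  U s -> V t ->
  (forall s t, U s -> V t -> is_derive (fun x => f x t) s (A s t)) ->
  is_derive (fun y => f s y) t (B s t) ->
  continuity_2d_pt A s t ->
  continuity_2d_pt f s t.
Proof.
  intros Us Vt HA HB CA.
  apply differentiable_continuity_pt. exists (A s t), (B s t).
  apply filterdiff_differentiable_pt_lim.
  apply (is_derive_filterdiff f s t A (B s t)).
  - apply (locally_2d_locally (fun u v => is_derive (fun z => f z v) u (A u v))).
    apply locally_2d_product; auto.
  - exact HB.
  - now apply continuity_2d_pt_filterlim in CA.
Qed.

End Smoothness.

(** * Primitives of closed forms on a rectangle *)

Lemma continuity_2d_slice_l f s t :
  continuity_2d_pt f s t -> continuous (fun x => f x t) s.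
Proof.
  intros Hf. apply continuity_pt_filterlim. intros eps He.
  destruct (Hf (mkposreal eps He)) as [d Hd].
  exists d. split; [apply cond_pos |]. intros x [_ Hx].
  apply Hd; [exact Hx |]. rewrite Rminus_eq_0, Rabs_R0. apply cond_pos.
Qed.

Lemma continuity_2d_slice_r f s t :
  continuity_2d_pt f s t -> continuous (fun y => f s y) t.
Proof.
  intros Hf. apply continuity_pt_filterlim. intros eps He.
  destruct (Hf (mkposreal eps He)) as [d Hd].
  exists d. split; [apply cond_pos |]. intros x [_ Hx].
  apply Hd; [| exact Hx]. rewrite Rminus_eq_0, Rabs_R0. apply cond_pos.
Qed.

Lemma open_in_oint a b : open (in_oint a b).
Proof. apply open_and; [apply open_Rbar_gt | apply open_Rbar_lt]. Qed.

Lemma in_oint_between a b x y z :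
  in_oint a b x -> in_oint a b y -> Rmin x y <= z <= Rmax x y -> in_oint a b z.
Proof.
  intros [H1 H2] [H3 H4] [Hl Hr]. split.
  - apply Rbar_lt_le_trans with (Rmin x y); [| exact Hl].
    unfold Rmin. now destruct (Rle_dec x y).
  - apply Rbar_le_lt_trans with (Rmax x y); [exact Hr |].
    unfold Rmax. now destruct (Rle_dec x y).
Qed.

Lemma in_oint_inhabited a b : Rbar_lt a b -> exists x, in_oint a b x.
Proof.
  unfold in_oint. destruct a as [a | |], b as [b | |]; simpl; try easy; intros Hab.
  - exists ((a + b) / 2). simpl. lra.
  - exists (a + 1). simpl. lra.
  - exists (b - 1). simpl. lra.
  - now exists 0.
Qed.

Lemma is_derive_primitive a b (f : R -> R) x0 x :
  (forall z, in_oint a b z -> continuous f z) ->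
  in_oint a b x0 -> in_oint a b x ->
  is_derive (fun y => RInt f x0 y) x (f x).
Proof.
  intros Cf H0 Hx. apply (is_derive_RInt f (RInt f x0) x0 x).
  - apply (filter_imp (in_oint a b)); [| now apply open_in_oint].
    intros y Hy. apply (RInt_correct (V := R_CompleteNormedModule)).
    apply (ex_RInt_continuous (V := R_CompleteNormedModule)).
    intros z Hz. apply Cf. now apply in_oint_between with x0 y.
  - now apply Cf.
Qed.

(** Poincare's lemma, by integrating the form [P ds + Q dt] from [(s0,t0)] first
    along the [t] axis and then along the [s] axis.  Differentiating under the
    integral sign and using [P_t = Q_s] recovers [Q]. *)
Lemma closed_form_primitive a b c d P Q :
  Rbar_lt a b -> Rbar_lt c d ->
  smooth (in_oint a b) (in_oint c d) P -> smooth (in_oint a b) (in_oint c d) Q ->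
  (forall s t, in_oint a b s -> in_oint c d t -> dt P s t = ds Q s t) ->
  exists theta, smooth (in_oint a b) (in_oint c d) theta /\
    forall s t, in_oint a b s -> in_oint c d t ->
      ds theta s t = P s t /\ dt theta s t = Q s t.
Proof.
  intros Hab Hcd HP HQ closed.
  destruct (in_oint_inhabited a b Hab) as [s0 Hs0].
  destruct (in_oint_inhabited c d Hcd) as [t0 Ht0].
  assert (oU := open_in_oint a b). assert (oV := open_in_oint c d).
  set (U := in_oint a b) in *. set (V := in_oint c d) in *.
  pose (theta s t := RInt (fun u => P u t) s0 s + RInt (fun v => Q s0 v) t0 t).
  assert (CP : forall s t, U s -> V t -> continuous (fun x => P x t) s).
  { intros s t Us Vt. apply (continuity_2d_slice_l P). now apply (smooth_continuous U V). }
  assert (Hs : forall s t, U s -> V t -> is_derive (fun x => theta x t) s (P s t)).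
  { intros s t Us Vt. rewrite <- (Rplus_0_r (P s t)).
    apply @is_derive_plus; [| apply @is_derive_const].
    apply (is_derive_primitive a b (fun u => P u t)); auto. }
  assert (Ht : forall s t, U s -> V t -> is_derive (fun y => theta s y) t (Q s t)).
  { intros s t Us Vt.
    assert (between : forall z, Rmin s0 s <= z <= Rmax s0 s -> U z).
    { intros z Hz. now apply in_oint_between with s0 s. }
    replace (Q s t) with (RInt (fun u => dt P u t) s0 s + Q s0 t).
    - apply @is_derive_plus.
      + apply (is_derive_RInt_param (fun y u => P u y) s0 s t).
        * apply (filter_imp V); [| now apply oV]. intros y Vy u Hu.
          apply (smooth_ex_dt U V); auto.
        * intros u Hu eps.
          destruct (smooth_continuous U V _ u t (smooth_dt U V P HP) (between u Hu) Vt eps)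
            as [e He].
          exists e. intros y v Hy Hv. now apply He.
        * apply (filter_imp V); [| now apply oV]. intros y Vy.
          apply (ex_RInt_continuous (V := R_CompleteNormedModule)).
          intros z Hz. now apply (CP z y); auto.
      + apply (is_derive_primitive c d (fun v => Q s0 v)); auto.
        intros z Vz. apply (continuity_2d_slice_r Q). now apply (smooth_continuous U V).
    - rewrite (RInt_ext _ (Derive (fun u => Q u t))).
      + rewrite RInt_Derive; [ring | |].
        * intros z Hz. apply (smooth_ex_ds U V Q); auto.
        * intros z Hz. apply (continuity_2d_slice_l (ds Q)).
          apply (smooth_continuous U V); auto. now apply smooth_ds.
      + intros z Hz. apply closed; auto. apply between. lra. }
  exists theta. split.
  - apply (smooth_bootstrap U V oU oV theta P Q); auto.
    + intros s t Us Vt. apply (continuity_of_partials U V oU oV theta P Q); auto.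
      now apply (smooth_continuous U V).
    + intros n _. exact (conj (HP n) (HQ n)).
  - intros s t Us Vt. split; apply is_derive_unique; auto.
Qed.

(** * Lorentzian vector algebra *)

Lemma E13_eq (x y : E13) : x1 x = x1 y -> x2 x = x2 y -> x3 x = x3 y -> x = y.
Proof.
  destruct x as [[a b] c], y as [[a' b'] c']. unfold x1, x2, x3. simpl.
  now intros -> -> ->.
Qed.

Lemma plus_lincomb (x y : E13) : plus x y = lincomb 1 x 1 y.
Proof.
  unfold lincomb. rewrite (scal_one x : scal 1 x = x).
  now rewrite (scal_one y : scal 1 y = y).
Qed.

Lemma lincomb_0_l x b y : lincomb 0 x b y = scal b y.
Proof. unfold lincomb. rewrite (scal_zero_l x : scal 0 x = zero). apply plus_zero_l. Qed.

Lemma lincomb_0_r a x y : lincomb a x 0 y = scal a x.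
Proof. unfold lincomb. rewrite (scal_zero_l y : scal 0 y = zero). apply plus_zero_r. Qed.

Lemma lincomb_coords a x b y :
  x1 (lincomb a x b y) = a * x1 x + b * x1 y /\
  x2 (lincomb a x b y) = a * x2 x + b * x2 y /\
  x3 (lincomb a x b y) = a * x3 x + b * x3 y.
Proof. now repeat split. Qed.

Lemma ldot_comm x y : ldot x y = ldot y x.
Proof. unfold ldot. ring. Qed.

Lemma ldot_lincomb_l a x b y z :
  ldot (lincomb a x b y) z = a * ldot x z + b * ldot y z.
Proof.
  unfold ldot. destruct (lincomb_coords a x b y) as [-> [-> ->]]. ring.
Qed.

Lemma ldot_lincomb_r a x b y z :
  ldot z (lincomb a x b y) = a * ldot z x + b * ldot z y.
Proof. rewrite ldot_comm, ldot_lincomb_l, !(ldot_comm z). reflexivity. Qed.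

Lemma ldot_scal_l a x y : ldot (scal a x) y = a * ldot x y.
Proof.
  change (- (a * x1 x * x1 y) + a * x2 x * x2 y + a * x3 x * x3 y = a * ldot x y).
  unfold ldot. ring.
Qed.

Lemma lcross_lincomb_r x a y b z :
  lcross x (lincomb a y b z) = lincomb a (lcross x y) b (lcross x z).
Proof.
  destruct (lincomb_coords a y b z) as [e1 [e2 e3]].
  destruct (lincomb_coords a (lcross x y) b (lcross x z)) as [e4 [e5 e6]].
  apply E13_eq; rewrite ?e4, ?e5, ?e6; unfold lcross; rewrite e1, e2, e3;
    unfold x1, x2, x3; simpl; ring.
Qed.

Lemma lcross_lcross x y :
  lcross x (lcross x y) = lincomb (ldot x x) y (- ldot x y) x.
Proof.
  destruct (lincomb_coords (ldot x x) y (- ldot x y) x) as [e1 [e2 e3]].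
  apply E13_eq; rewrite ?e1, ?e2, ?e3; unfold lcross, ldot, x1, x2, x3; simpl; ring.
Qed.

Lemma ldot_lcross x y z w :
  ldot (lcross x y) (lcross z w) = ldot x w * ldot y z - ldot x z * ldot y w.
Proof. unfold ldot, lcross, x1, x2, x3. simpl. ring. Qed.

Lemma ldot_lcross_l x y : ldot x (lcross x y) = 0.
Proof. unfold ldot, lcross, x1, x2, x3. simpl. ring. Qed.

Lemma ldot_lcross_r x y : ldot y (lcross x y) = 0.
Proof. unfold ldot, lcross, x1, x2, x3. simpl. ring. Qed.

Lemma ldot_lcross_swap x y z : ldot (lcross x y) z = - ldot (lcross x z) y.
Proof. unfold ldot, lcross, x1, x2, x3. simpl. ring. Qed.

(** Such a pair determines an orthonormal basis, whose third vector
    [lcross T E] is timelike: frames are encoded by their first two vectors. *)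
Definition adapted (T E : E13) : Prop :=
  ldot T T = 1 /\ ldot E E = 1 /\ ldot T E = 0.

Lemma adapted_lcross T E : adapted T E -> ldot (lcross T E) (lcross T E) = -1.
Proof.
  intros [HT [HE HTE]]. rewrite ldot_lcross, (ldot_comm E T), HT, HE, HTE. ring.
Qed.

(** Cramer's rule in the basis [T], [E], [lcross T E], whose Gram determinant
    is [-1]. *)
Lemma adapted_expansion T E x : adapted T E ->
  x = plus (scal (ldot x T) T)
        (lincomb (ldot x E) E (- ldot x (lcross T E)) (lcross T E)).
Proof.
  intros [HT [HE HTE]].
  assert (H : forall p : E13 -> R, p = x1 \/ p = x2 \/ p = x3 ->
    p x * (ldot T T * ldot E E - ldot T E * ldot T E) =
    (ldot x T * ldot E E - ldot x E * ldot T E) * p T +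
    (ldot x E * ldot T T - ldot x T * ldot T E) * p E
    - ldot x (lcross T E) * p (lcross T E)).
  { intros p [-> | [-> | ->]]; unfold ldot, lcross, x1, x2, x3; simpl; ring. }
  rewrite HT, HE, HTE in H.
  apply E13_eq; unfold lincomb.
  - specialize (H x1 ltac:(tauto)).
    transitivity (ldot x T * x1 T + (ldot x E * x1 E + - ldot x (lcross T E) * x1 (lcross T E)));
      [lra | reflexivity].
  - specialize (H x2 ltac:(tauto)).
    transitivity (ldot x T * x2 T + (ldot x E * x2 E + - ldot x (lcross T E) * x2 (lcross T E)));
      [lra | reflexivity].
  - specialize (H x3 ltac:(tauto)).
    transitivity (ldot x T * x3 T + (ldot x E * x3 E + - ldot x (lcross T E) * x3 (lcross T E)));
      [lra | reflexivity].
Qed.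

Lemma adapted_parseval T E x y : adapted T E ->
  ldot x y = ldot x T * ldot y T + ldot x E * ldot y E
             - ldot x (lcross T E) * ldot y (lcross T E).
Proof.
  intros H. rewrite (adapted_expansion T E x H) at 1.
  rewrite plus_lincomb, !ldot_lincomb_l, ldot_scal_l, !(ldot_comm _ y). ring.
Qed.

Lemma adapted_expansion_normal T E x : adapted T E -> ldot x T = 0 ->
  x = lincomb (ldot x E) E (- ldot x (lcross T E)) (lcross T E).
Proof.
  intros H H0. rewrite (adapted_expansion T E x H) at 1. rewrite H0.
  rewrite (scal_zero_l T : scal 0 T = zero). apply plus_zero_l.
Qed.

(** * Hyperbolic rotations of adapted frames *)

(** The plane orthogonal to the unit spacelike vector [T] is Lorentzian, and
    vector multiplication by [T] exchanges the two vectors of an orthonormal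
    basis of it; the rotations of this plane are therefore hyperbolic. *)
Definition hrot (T N : E13) (th : R) : E13 :=
  lincomb (cosh th) N (sinh th) (lcross T N).

Lemma cosh_sinh_sqr x : cosh x * cosh x - sinh x * sinh x = 1.
Proof.
  unfold cosh, sinh. replace 1 with (exp x * exp (- x)); [field |].
  rewrite <- exp_plus, Rplus_opp_r. apply exp_0.
Qed.

Lemma lcross_hrot T N th : adapted T N ->
  lcross T (hrot T N th) = lincomb (sinh th) N (cosh th) (lcross T N).
Proof.
  intros [HT [HN HTN]]. unfold hrot.
  rewrite lcross_lincomb_r, lcross_lcross, HT, HTN, Ropp_0, lincomb_0_r.
  rewrite (scal_one N : scal 1 N = N). apply plus_comm.
Qed.

Lemma adapted_hrot T N th : adapted T N -> adapted T (hrot T N th).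
Proof.
  intros H. assert (HB := adapted_lcross T N H). destruct H as [HT [HN HTN]].
  assert (C := cosh_sinh_sqr th).
  unfold adapted, hrot. rewrite !ldot_lincomb_l, !ldot_lincomb_r, !(ldot_comm (lcross T N) N).
  rewrite HT, HTN, HN, HB, ldot_lcross_l, ldot_lcross_r. repeat split; lra.
Qed.

(** * Derivatives of curves *)

Definition vdifferentiable (c : R -> E13) (s : R) : Prop :=
  ex_derive (fun x => x1 (c x)) s /\ ex_derive (fun x => x2 (c x)) s /\
  ex_derive (fun x => x3 (c x)) s.

Ltac derive_products :=
  evar_last;
  [ repeat first
      [ apply Derive_correct; assumption
      | lazymatch goal with
        | |- is_derive (fun x => _ * _) _ _ => apply is_derive_Rmult
        | |- is_derive (fun x => _ + _) _ _ => apply @is_derive_plus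
        | |- is_derive (fun x => _ - _) _ _ => apply @is_derive_minus
        | |- is_derive (fun x => - _) _ _ => apply @is_derive_opp
        end ]
  | unfold minus, plus, opp; simpl; ring ].

Lemma is_derive_lincomb_coord (f c g e : R -> R) s :
  ex_derive f s -> ex_derive g s -> ex_derive c s -> ex_derive e s ->
  is_derive (fun x => f x * c x + g x * e x) s
    ((Derive f s * c s + Derive g s * e s) + (f s * Derive c s + g s * Derive e s)).
Proof. intros; derive_products. Qed.

Lemma is_derive_ldot_coord (f1 f2 f3 g1 g2 g3 : R -> R) s :
  ex_derive f1 s -> ex_derive f2 s -> ex_derive f3 s ->
  ex_derive g1 s -> ex_derive g2 s -> ex_derive g3 s ->
  is_derive (fun x => - (f1 x * g1 x) + f2 x * g2 x + f3 x * g3 x) s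
    ((- (Derive f1 s * g1 s) + Derive f2 s * g2 s + Derive f3 s * g3 s) +
     (- (f1 s * Derive g1 s) + f2 s * Derive g2 s + f3 s * Derive g3 s)).
Proof. intros; derive_products. Qed.

Lemma is_derive_lcross_coord1 (f g h k : R -> R) s :
  ex_derive f s -> ex_derive g s -> ex_derive h s -> ex_derive k s ->
  is_derive (fun x => - (f x * g x) + h x * k x) s
    ((- (Derive f s * g s) + Derive h s * k s) +
     (- (f s * Derive g s) + h s * Derive k s)).
Proof. intros; derive_products. Qed.

Lemma is_derive_lcross_coord2 (f g h k : R -> R) s :
  ex_derive f s -> ex_derive g s -> ex_derive h s -> ex_derive k s ->
  is_derive (fun x => f x * g x - h x * k x) s
    ((Derive f s * g s - Derive h s * k s) + (f s * Derive g s - h s * Derive k s)).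
Proof. intros; derive_products. Qed.

Lemma is_derive_ldot c e s : vdifferentiable c s -> vdifferentiable e s ->
  is_derive (fun x => ldot (c x) (e x)) s
    (ldot (vderive c s) (e s) + ldot (c s) (vderive e s)).
Proof.
  intros [c1 [c2 c3]] [e1 [e2 e3]].
  exact (is_derive_ldot_coord _ _ _ _ _ _ s c1 c2 c3 e1 e2 e3).
Qed.

Lemma ldot_orthogonal_derive c e s k :
  vdifferentiable c s -> vdifferentiable e s ->
  locally s (fun x => ldot (c x) (e x) = k) ->
  ldot (vderive c s) (e s) + ldot (c s) (vderive e s) = 0.
Proof.
  intros Hc He Hk. rewrite <- (is_derive_unique _ _ _ (is_derive_ldot c e s Hc He)).
  rewrite (Derive_ext_loc _ (fun _ => k)) by exact Hk. apply Derive_const.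
Qed.

Lemma vderive_lcross c e s :
  vdifferentiable c s -> vdifferentiable e s ->
  vdifferentiable (fun x => lcross (c x) (e x)) s /\
  vderive (fun x => lcross (c x) (e x)) s =
  plus (lcross (vderive c s) (e s)) (lcross (c s) (vderive e s)).
Proof.
  intros [c1 [c2 c3]] [e1 [e2 e3]].
  assert (H1 := is_derive_lcross_coord1 _ _ _ _ s c2 e3 c3 e2).
  assert (H2 := is_derive_lcross_coord2 _ _ _ _ s c3 e1 c1 e3).
  assert (H3 := is_derive_lcross_coord2 _ _ _ _ s c1 e2 c2 e1).
  split.
  - split; [| split]; eexists; [exact H1 | exact H2 | exact H3].
  - apply E13_eq; apply is_derive_unique; [exact H1 | exact H2 | exact H3].
Qed.

Lemma vderive_lincomb (f : R -> R) c (g : R -> R) e s :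
  ex_derive f s -> ex_derive g s -> vdifferentiable c s -> vdifferentiable e s ->
  vdifferentiable (fun x => lincomb (f x) (c x) (g x) (e x)) s /\
  vderive (fun x => lincomb (f x) (c x) (g x) (e x)) s =
  plus (lincomb (Derive f s) (c s) (Derive g s) (e s))
       (lincomb (f s) (vderive c s) (g s) (vderive e s)).
Proof.
  intros Hf Hg [c1 [c2 c3]] [e1 [e2 e3]].
  assert (H1 := is_derive_lincomb_coord f _ g _ s Hf Hg c1 e1).
  assert (H2 := is_derive_lincomb_coord f _ g _ s Hf Hg c2 e2).
  assert (H3 := is_derive_lincomb_coord f _ g _ s Hf Hg c3 e3).
  split.
  - split; [| split]; eexists; [exact H1 | exact H2 | exact H3].
  - apply E13_eq; apply is_derive_unique; [exact H1 | exact H2 | exact H3].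
Qed.

(** The matrix of the derivative of an orthonormal frame is skew for the
    Lorentzian product, so that three coefficients determine it. *)
Lemma moving_frame (T E : R -> E13) s :
  vdifferentiable T s -> vdifferentiable E s ->
  locally s (fun x => adapted (T x) (E x)) ->
  let B := fun x => lcross (T x) (E x) in
  let T' := vderive T s in
  let w := - ldot (vderive E s) (B s) in
  T' = lincomb (ldot T' (E s)) (E s) (- ldot T' (B s)) (B s) /\
  vderive E s = lincomb (- ldot T' (E s)) (T s) w (B s) /\
  vderive B s = lincomb (- ldot T' (B s)) (T s) w (E s).
Proof.
  intros DT DE HA B T' w.
  assert (DB : vdifferentiable B s) by now apply vderive_lcross.
  assert (H : adapted (T s) (E s)) by now apply locally_singleton in HA.
  assert (TT : ldot T' (T s) + ldot (T s) T' = 0).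
  { apply (ldot_orthogonal_derive _ _ _ 1); auto.
    apply filter_imp with (2 := HA). intros x Hx. apply Hx. }
  assert (EE : ldot (vderive E s) (E s) + ldot (E s) (vderive E s) = 0).
  { apply (ldot_orthogonal_derive _ _ _ 1); auto.
    apply filter_imp with (2 := HA). intros x Hx. apply Hx. }
  assert (BB : ldot (vderive B s) (B s) + ldot (B s) (vderive B s) = 0).
  { apply (ldot_orthogonal_derive _ _ _ (-1)); auto.
    apply filter_imp with (2 := HA). intros x Hx. now apply adapted_lcross. }
  assert (TE : ldot T' (E s) + ldot (T s) (vderive E s) = 0).
  { apply (ldot_orthogonal_derive _ _ _ 0); auto.
    apply filter_imp with (2 := HA). intros x Hx. apply Hx. }
  assert (TB : ldot T' (B s) + ldot (T s) (vderive B s) = 0).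
  { apply (ldot_orthogonal_derive _ _ _ 0); auto.
    apply filter_imp with (2 := HA). intros x Hx. apply ldot_lcross_l. }
  assert (EB : ldot (vderive E s) (B s) + ldot (E s) (vderive B s) = 0).
  { apply (ldot_orthogonal_derive _ _ _ 0); auto.
    apply filter_imp with (2 := HA). intros x Hx. apply ldot_lcross_r. }
  rewrite (ldot_comm (T s) T') in TT.
  rewrite (ldot_comm (E s)) in EE, EB. rewrite (ldot_comm (B s)) in BB.
  rewrite (ldot_comm (T s)) in TE, TB.
  split; [| split].
  - apply adapted_expansion_normal; auto. lra.
  - rewrite (adapted_expansion (T s) (E s) (vderive E s) H) at 1.
    fold (B s). fold w.
    replace (ldot (vderive E s) (E s)) with 0 by lra.
    replace (ldot (vderive E s) (T s)) with (- ldot T' (E s)) by lra.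
    now rewrite lincomb_0_l.
  - rewrite (adapted_expansion (T s) (E s) (vderive B s) H) at 1.
    fold (B s).
    replace (ldot (vderive B s) (B s)) with 0 by lra.
    replace (ldot (vderive B s) (T s)) with (- ldot T' (B s)) by lra.
    replace (ldot (vderive B s) (E s)) with w by (unfold w; lra).
    now rewrite Ropp_0, lincomb_0_r.
Qed.

(** Rotations of the normal plane commute, so that the speed of the angle is
    simply superposed on that of the frame; it enters with a minus sign because
    the vector against which the derivative is measured is timelike. *)
Lemma rotation_speed_hrot (T N : R -> E13) (th : R -> R) s :
  vdifferentiable T s -> vdifferentiable N s -> ex_derive th s ->
  locally s (fun x => adapted (T x) (N x)) ->
  vdifferentiable (fun x => hrot (T x) (N x) (th x)) s /\
  ldot (vderive (fun x => hrot (T x) (N x) (th x)) s)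
       (lcross (T s) (hrot (T s) (N s) (th s))) =
  ldot (vderive N s) (lcross (T s) (N s)) - Derive th s.
Proof.
  intros DT DN Dth HA.
  set (B := fun x => lcross (T x) (N x)).
  assert (DB : vdifferentiable B s) by now apply vderive_lcross.
  assert (Hc : is_derive (fun x => cosh (th x)) s (sinh (th s) * Derive th s)).
  { rewrite Rmult_comm. apply (is_derive_comp cosh th); [| now apply Derive_correct].
    apply is_derive_Reals, derivable_pt_lim_cosh. }
  assert (Hs : is_derive (fun x => sinh (th x)) s (cosh (th s) * Derive th s)).
  { rewrite Rmult_comm. apply (is_derive_comp sinh th); [| now apply Derive_correct].
    apply is_derive_Reals, derivable_pt_lim_sinh. }
  destruct (vderive_lincomb (fun x => cosh (th x)) N (fun x => sinh (th x)) B s)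
    as [Dh Eh]; auto; [now eexists; apply Hc | now eexists; apply Hs |].
  split; [exact Dh |].
  change (fun x => hrot (T x) (N x) (th x))
    with (fun x => lincomb (cosh (th x)) (N x) (sinh (th x)) (B x)).
  rewrite Eh.
  rewrite (is_derive_unique _ _ _ Hc : Derive (fun x : R => cosh (th x)) s = _).
  rewrite (is_derive_unique _ _ _ Hs : Derive (fun x : R => sinh (th x)) s = _).
  assert (H : adapted (T s) (N s)) by now apply locally_singleton in HA.
  rewrite lcross_hrot by exact H.
  destruct (moving_frame T N s DT DN HA) as [_ [HN HB]]. cbv zeta in HN, HB.
  fold (B s). fold B in HB. fold (B s) in HN, HB.
  assert (hNN : ldot (vderive N s) (N s) = 0).
  { rewrite HN, ldot_lincomb_l. destruct H as [_ [_ H]].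
    rewrite H, (ldot_comm (B s)). unfold B. rewrite ldot_lcross_r. ring. }
  assert (hBB : ldot (vderive B s) (B s) = 0).
  { rewrite HB, ldot_lincomb_l. unfold B at 2 4. rewrite ldot_lcross_r, ldot_lcross_l. ring. }
  assert (hBN : ldot (vderive B s) (N s) = - ldot (vderive N s) (B s)).
  { rewrite HB, ldot_lincomb_l. destruct H as [_ [H1 H2]]. rewrite H1, H2. ring. }
  assert (C := cosh_sinh_sqr (th s)).
  assert (Bs := adapted_lcross _ _ H). fold (B s) in Bs.
  assert (NB : ldot (N s) (B s) = 0) by apply ldot_lcross_r.
  destruct H as [_ [NN _]].
  rewrite plus_lincomb, !ldot_lincomb_l, !ldot_lincomb_r.
  rewrite (ldot_comm (B s) (N s)), NB, NN, Bs, hNN, hBB, hBN.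
  transitivity ((cosh (th s) * cosh (th s) - sinh (th s) * sinh (th s)) *
    (ldot (vderive N s) (B s) - Derive th s)); [ring | rewrite C; ring].
Qed.

(** * Calculus of smooth vector fields on a product of open sets *)

Section VectorFields.

Context (U V : R -> Prop) (openU : open U) (openV : open V).

Lemma vsmooth_vds F : vsmooth U V F -> vsmooth U V (vds F).
Proof.
  intros [F1 [F2 F3]].
  exact (conj (smooth_ds U V _ F1) (conj (smooth_ds U V _ F2) (smooth_ds U V _ F3))).
Qed.

Lemma vsmooth_vdt F : vsmooth U V F -> vsmooth U V (vdt F).
Proof.
  intros [F1 [F2 F3]].
  exact (conj (smooth_dt U V _ F1) (conj (smooth_dt U V _ F2) (smooth_dt U V _ F3))).
Qed.

Lemma vsmooth_differentiable_s F s t :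
  vsmooth U V F -> U s -> V t -> vdifferentiable (fun x => F x t) s.
Proof.
  intros [F1 [F2 F3]] Us Vt. split; [| split].
  - exact (smooth_ex_ds U V _ s t F1 Us Vt).
  - exact (smooth_ex_ds U V _ s t F2 Us Vt).
  - exact (smooth_ex_ds U V _ s t F3 Us Vt).
Qed.

Lemma vsmooth_differentiable_t F s t :
  vsmooth U V F -> U s -> V t -> vdifferentiable (fun y => F s y) t.
Proof.
  intros [F1 [F2 F3]] Us Vt. split; [| split].
  - exact (smooth_ex_dt U V _ s t F1 Us Vt).
  - exact (smooth_ex_dt U V _ s t F2 Us Vt).
  - exact (smooth_ex_dt U V _ s t F3 Us Vt).
Qed.

Lemma smooth_ldot F G :
  vsmooth U V F -> vsmooth U V G -> smooth U V (fun s t => ldot (F s t) (G s t)).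
Proof.
  intros [F1 [F2 F3]] [G1 [G2 G3]]. unfold ldot.
  apply smooth_plus; auto; [apply smooth_plus; auto; [apply smooth_opp; auto |] |];
    now apply smooth_mult.
Qed.

Lemma vsmooth_lcross F G :
  vsmooth U V F -> vsmooth U V G -> vsmooth U V (fun s t => lcross (F s t) (G s t)).
Proof.
  intros [F1 [F2 F3]] [G1 [G2 G3]]. unfold lcross. split; [| split].
  - apply (smooth_plus U V openU openV (fun s t => - (x2 (F s t) * x3 (G s t)))).
    + apply smooth_opp; auto. now apply smooth_mult.
    + now apply smooth_mult.
  - apply (smooth_minus U V openU openV (fun s t => x3 (F s t) * x1 (G s t))
             (fun s t => x1 (F s t) * x3 (G s t))); now apply smooth_mult.
  - apply (smooth_minus U V openU openV (fun s t => x1 (F s t) * x2 (G s t))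
             (fun s t => x2 (F s t) * x1 (G s t))); now apply smooth_mult.
Qed.

Lemma vsmooth_scal f F :
  smooth U V f -> vsmooth U V F -> vsmooth U V (fun s t => scal (f s t) (F s t)).
Proof.
  intros Hf [F1 [F2 F3]]. split; [| split].
  - exact (smooth_mult U V openU openV f _ Hf F1).
  - exact (smooth_mult U V openU openV f _ Hf F2).
  - exact (smooth_mult U V openU openV f _ Hf F3).
Qed.

Lemma vsmooth_lincomb f F g G :
  smooth U V f -> vsmooth U V F -> smooth U V g -> vsmooth U V G ->
  vsmooth U V (fun s t => lincomb (f s t) (F s t) (g s t) (G s t)).
Proof.
  intros Hf HF Hg HG.
  destruct (vsmooth_scal f F Hf HF) as [F1 [F2 F3]].
  destruct (vsmooth_scal g G Hg HG) as [G1 [G2 G3]].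
  split; [| split].
  - exact (smooth_plus U V openU openV _ _ F1 G1).
  - exact (smooth_plus U V openU openV _ _ F2 G2).
  - exact (smooth_plus U V openU openV _ _ F3 G3).
Qed.

Lemma ds_ldot F G s t : vsmooth U V F -> vsmooth U V G -> U s -> V t ->
  ds (fun s t => ldot (F s t) (G s t)) s t =
  ldot (vds F s t) (G s t) + ldot (F s t) (vds G s t).
Proof.
  intros HF HG Us Vt. apply is_derive_unique.
  apply (is_derive_ldot (fun x => F x t) (fun x => G x t));
    now apply vsmooth_differentiable_s.
Qed.

Lemma dt_ldot F G s t : vsmooth U V F -> vsmooth U V G -> U s -> V t ->
  dt (fun s t => ldot (F s t) (G s t)) s t =
  ldot (vdt F s t) (G s t) + ldot (F s t) (vdt G s t).
Proof.
  intros HF HG Us Vt. apply is_derive_unique.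
  apply (is_derive_ldot (fun y => F s y) (fun y => G s y));
    now apply vsmooth_differentiable_t.
Qed.

Lemma ds_ext f g s t : (forall s t, U s -> V t -> f s t = g s t) ->
  U s -> V t -> ds f s t = ds g s t.
Proof.
  intros E Us Vt. apply Derive_ext_loc.
  apply (filter_imp U); [| now apply openU]. intros x Ux. now apply E.
Qed.

Lemma dt_ext f g s t : (forall s t, U s -> V t -> f s t = g s t) ->
  U s -> V t -> dt f s t = dt g s t.
Proof.
  intros E Us Vt. apply Derive_ext_loc.
  apply (filter_imp V); [| now apply openV]. intros y Vy. now apply E.
Qed.

Lemma vds_ext F G s t : (forall s t, U s -> V t -> F s t = G s t) ->
  U s -> V t -> vds F s t = vds G s t.
Proof.
  intros E Us Vt. unfold vds, vderive. f_equal; [f_equal |].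
  - apply (ds_ext (fun s t => x1 (F s t)) (fun s t => x1 (G s t))); auto.
    intros; now rewrite E.
  - apply (ds_ext (fun s t => x2 (F s t)) (fun s t => x2 (G s t))); auto.
    intros; now rewrite E.
  - apply (ds_ext (fun s t => x3 (F s t)) (fun s t => x3 (G s t))); auto.
    intros; now rewrite E.
Qed.

Lemma vsmooth_schwarz F s t : vsmooth U V F -> U s -> V t ->
  vdt (vds F) s t = vds (vdt F) s t.
Proof.
  intros [F1 [F2 F3]] Us Vt. apply E13_eq.
  - exact (smooth_schwarz U V openU openV _ s t F1 Us Vt).
  - exact (smooth_schwarz U V openU openV _ s t F2 Us Vt).
  - exact (smooth_schwarz U V openU openV _ s t F3 Us Vt).
Qed.

(** * Evolving frames and the non-linear heat system *)

(** The system is the integrability condition of the frame equations: the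
    [T]-components of the mixed derivatives of [E1] and [E2], computed from
    either equation, must agree. *)
Lemma frame_compatibility T E1 E2 k1 k2 s t :
  vsmooth U V T -> vsmooth U V E1 -> vsmooth U V E2 ->
  (forall s t, U s -> V t ->
     adapted (T s t) (E1 s t) /\ ldot (E2 s t) (E2 s t) = -1 /\
     ldot (T s t) (E2 s t) = 0 /\ ldot (E1 s t) (E2 s t) = 0) ->
  frame_system_s U V T E1 E2 k1 k2 -> frame_system_t U V T E1 E2 k1 k2 ->
  U s -> V t ->
  dt k1 s t = ds (ds k2) s t + 1 / 2 * (k1 s t ^ 2 - k2 s t ^ 2) * k2 s t /\
  dt k2 s t = ds (ds k1) s t + 1 / 2 * (k1 s t ^ 2 - k2 s t ^ 2) * k1 s t.
Proof.
  intros ST S1 S2 orth FS FT Us Vt.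
  (* Both sides are the T-component of the mixed derivative of E. *)
  assert (mixed : forall E, vsmooth U V E ->
    dt (fun s t => ldot (vds E s t) (T s t)) s t - ldot (vds E s t) (vdt T s t) =
    ds (fun s t => ldot (vdt E s t) (T s t)) s t - ldot (vdt E s t) (vds T s t)).
  { intros E SE. rewrite dt_ldot, ds_ldot, (vsmooth_schwarz E);
      auto using vsmooth_vds, vsmooth_vdt. ring. }
  assert (M1 := mixed E1 S1). assert (M2 := mixed E2 S2).
  destruct (orth s t Us Vt) as [[TT [EE TE]] [BB [TB EB]]].
  destruct (FS s t Us Vt) as [Ts [E1s E2s]].
  destruct (FT s t Us Vt) as [Tt [E1t E2t]].
  rewrite (dt_ext _ (fun s t => - k1 s t)) in M1; auto.
  2: { intros u v Uu Vv. destruct (FS u v Uu Vv) as [_ [-> _]].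
       rewrite ldot_scal_l. destruct (orth u v Uu Vv) as [[-> _] _]. ring. }
  rewrite (ds_ext _ (fun s t => - ds k2 s t)) in M1; auto.
  2: { intros u v Uu Vv. destruct (FT u v Uu Vv) as [_ [-> _]].
       rewrite ldot_lincomb_l, (ldot_comm (E2 u v)).
       destruct (orth u v Uu Vv) as [[-> _] [_ [-> _]]]. ring. }
  rewrite (dt_ext _ (fun s t => k2 s t)) in M2; auto.
  2: { intros u v Uu Vv. destruct (FS u v Uu Vv) as [_ [_ ->]].
       rewrite ldot_scal_l. destruct (orth u v Uu Vv) as [[-> _] _]. ring. }
  rewrite (ds_ext _ (fun s t => ds k1 s t)) in M2; auto.
  2: { intros u v Uu Vv. destruct (FT u v Uu Vv) as [_ [_ ->]].
       rewrite ldot_lincomb_l, (ldot_comm (E1 u v)).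
       destruct (orth u v Uu Vv) as [[-> [_ ->]] _]. ring. }
  rewrite E1s, E1t, Ts, Tt, ldot_scal_l, !ldot_lincomb_l, !ldot_lincomb_r,
    (ldot_comm (E2 s t) (E1 s t)), TE, TB, EB, BB in M1.
  rewrite E2s, E2t, Ts, Tt, ldot_scal_l, !ldot_lincomb_l, !ldot_lincomb_r,
    TE, TB, EB, EE in M2.
  assert (N1 : dt (fun s t => - k1 s t) s t = - dt k1 s t) by apply Derive_opp.
  assert (N2 : ds (fun s t => - ds k2 s t) s t = - ds (ds k2) s t) by apply Derive_opp.
  assert (N3 : dt (fun s t => k2 s t) s t = dt k2 s t) by reflexivity.
  assert (N4 : ds (fun s t => ds k1 s t) s t = ds (ds k1) s t) by reflexivity.
  rewrite N1, N2 in M1. rewrite N3, N4 in M2.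
  split; lra.
Qed.

Lemma heat_system_of_principal_curvatures k1 k2 :
  smooth U V k1 -> smooth U V k2 ->
  (forall s t, U s -> V t ->
    dt k1 s t = ds (ds k2) s t + 1 / 2 * (k1 s t ^ 2 - k2 s t ^ 2) * k2 s t /\
    dt k2 s t = ds (ds k1) s t + 1 / 2 * (k1 s t ^ 2 - k2 s t ^ 2) * k1 s t) ->
  nonlinear_heat_system U V
    (fun s t => 1 / sqrt 2 * (k1 s t + k2 s t))
    (fun s t => 1 / sqrt 2 * (k1 s t - k2 s t)).
Proof.
  intros S1 S2 H. set (c := 1 / sqrt 2).
  assert (c2 : c * c = 1 / 2).
  { unfold c. assert (H2 := sqrt_sqrt 2 ltac:(lra)). assert (H3 := sqrt_lt_R0 2 ltac:(lra)).
    apply (Rmult_eq_reg_l (sqrt 2 * sqrt 2)); [| nra].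
    rewrite H2 at 2. field. lra. }
  split; [| split].
  - apply smooth_mult; auto using smooth_const, smooth_plus.
  - apply smooth_mult; auto using smooth_const, smooth_minus.
  - intros s t Us Vt. destruct (H s t Us Vt) as [H1 H2].
    assert (D : forall f g : R -> R, forall x, ex_derive f x -> ex_derive g x ->
      Derive (fun y => c * (f y + g y)) x = c * (Derive f x + Derive g x) /\
      Derive (fun y => c * (f y - g y)) x = c * (Derive f x - Derive g x)).
    { intros f g x Hf Hg. rewrite !Derive_scal, Derive_plus, Derive_minus; auto. }
    assert (T := D (fun y => k1 s y) (fun y => k2 s y) t
      (smooth_ex_dt U V k1 s t S1 Us Vt) (smooth_ex_dt U V k2 s t S2 Us Vt)).
    assert (SS := D (fun x => ds k1 x t) (fun x => ds k2 x t) s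
      (smooth_ex_ds U V (ds k1) s t (smooth_ds U V k1 S1) Us Vt)
      (smooth_ex_ds U V (ds k2) s t (smooth_ds U V k2 S2) Us Vt)).
    assert (Q : ds (ds (fun s t => c * (k1 s t + k2 s t))) s t =
                c * (ds (ds k1) s t + ds (ds k2) s t)).
    { rewrite (ds_ext (ds _) (fun s t => c * (ds k1 s t + ds k2 s t))); auto.
      - exact (proj1 SS).
      - intros u v Uu Vv. apply (D (fun x => k1 x v) (fun x => k2 x v) u);
          now apply (smooth_ex_ds U V). }
    assert (Rr : ds (ds (fun s t => c * (k1 s t - k2 s t))) s t =
                c * (ds (ds k1) s t - ds (ds k2) s t)).
    { rewrite (ds_ext (ds _) (fun s t => c * (ds k1 s t - ds k2 s t))); auto.
      - exact (proj2 SS).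
      - intros u v Uu Vv. apply (D (fun x => k1 x v) (fun x => k2 x v) u);
          now apply (smooth_ex_ds U V). }
    rewrite Q, Rr. unfold dt at 1 2. destruct T as [-> ->].
    change (Derive (fun y => k1 s y) t) with (dt k1 s t).
    change (Derive (fun y => k2 s y) t) with (dt k2 s t).
    rewrite H1, H2. split.
    + transitivity (c * (ds (ds k1) s t + ds (ds k2) s t)
        + c * (c * c) * (k1 s t + k2 s t) ^ 2 * (k1 s t - k2 s t)); [rewrite c2; field | ring].
    + transitivity (- (c * (ds (ds k1) s t - ds (ds k2) s t))
        - c * (c * c) * (k1 s t - k2 s t) ^ 2 * (k1 s t + k2 s t)); [rewrite c2; field | ring].
Qed.

End VectorFields.

(** * Parallel frames along a flow of unit tangents *)

(** The curves enter only through their tangent field [T], whose evolution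
    [flow] is the derivative of the vortex filament equation. *)
Section ParallelFrame.

Context (U V : R -> Prop) (openU : open U) (openV : open V).
Context (T : R -> R -> E13) (ST : vsmooth U V T).
Context (flow : forall s t, U s -> V t ->
  vdt T s t = lcross (T s t) (vds (vds T) s t)).

Definition adapted_field (E : R -> R -> E13) : Prop :=
  forall s t, U s -> V t -> adapted (T s t) (E s t).

Lemma moving_frame_s E s t : vsmooth U V E -> adapted_field E -> U s -> V t ->
  let B := fun s t => lcross (T s t) (E s t) in
  let w := - ldot (vds E s t) (B s t) in
  vds T s t = lincomb (ldot (vds T s t) (E s t)) (E s t)
                (- ldot (vds T s t) (B s t)) (B s t) /\
  vds E s t = lincomb (- ldot (vds T s t) (E s t)) (T s t) w (B s t) /\
  vds B s t = lincomb (- ldot (vds T s t) (B s t)) (T s t) w (E s t).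
Proof.
  intros SE HA Us Vt. apply (moving_frame (fun x => T x t) (fun x => E x t)).
  - now apply (vsmooth_differentiable_s U V).
  - now apply (vsmooth_differentiable_s U V).
  - apply (filter_imp U); [| now apply openU]. intros x Ux. now apply HA.
Qed.

Lemma moving_frame_t E s t : vsmooth U V E -> adapted_field E -> U s -> V t ->
  let B := fun s t => lcross (T s t) (E s t) in
  let w := - ldot (vdt E s t) (B s t) in
  vdt T s t = lincomb (ldot (vdt T s t) (E s t)) (E s t)
                (- ldot (vdt T s t) (B s t)) (B s t) /\
  vdt E s t = lincomb (- ldot (vdt T s t) (E s t)) (T s t) w (B s t) /\
  vdt B s t = lincomb (- ldot (vdt T s t) (B s t)) (T s t) w (E s t).
Proof.
  intros SE HA Us Vt. apply (moving_frame (fun y => T s y) (fun y => E s y)).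
  - now apply (vsmooth_differentiable_t U V).
  - now apply (vsmooth_differentiable_t U V).
  - apply (filter_imp V); [| now apply openV]. intros y Vy. now apply HA.
Qed.

Lemma tangent_orthogonal_ds E s t :
  vsmooth U V E -> adapted_field E -> U s -> V t -> ldot (vds T s t) (T s t) = 0.
Proof.
  intros SE HA Us Vt. destruct (moving_frame_s E s t SE HA Us Vt) as [H _].
  cbv zeta in H. rewrite H, ldot_lincomb_l.
  destruct (HA s t Us Vt) as [_ [_ TE]].
  rewrite (ldot_comm (E s t)), TE, (ldot_comm (lcross _ _)), ldot_lcross_l. ring.
Qed.

(** Multiplication by [T] exchanges the two normal components, which is why
    [k1] and [k2] change places in the evolution of the frame. *)
Lemma flow_components E s t : U s -> V t ->
  ldot (T s t) (E s t) = 0 -> ldot (T s t) (T s t) = 1 ->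
  ldot (vdt T s t) (E s t) =
    - ldot (vds (vds T) s t) (lcross (T s t) (E s t)) /\
  ldot (vdt T s t) (lcross (T s t) (E s t)) = - ldot (vds (vds T) s t) (E s t).
Proof.
  intros Us Vt TE TT. rewrite flow by auto. split.
  - rewrite ldot_lcross_swap, ldot_comm. reflexivity.
  - rewrite ldot_lcross, TT, TE. ring.
Qed.

(** The rotation speeds in [s] and [t] of an arbitrary normal frame satisfy a
    structure equation: their curl is expressed by the normal components of
    [T_s] and [T_t], and along the flow it equals [- <T_s,T_ss>], an exact
    [s]-derivative, which the added term compensates. *)
Lemma rotation_form_closed N : vsmooth U V N -> adapted_field N ->
  let B := fun s t => lcross (T s t) (N s t) in
  forall s t, U s -> V t ->
  dt (fun s t => ldot (vds N s t) (B s t)) s t =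
  ds (fun s t => ldot (vdt N s t) (B s t)
                 + - (1 / 2) * ldot (vds T s t) (vds T s t)) s t.
Proof.
  intros SN HA B s t Us Vt.
  assert (SB : vsmooth U V B) by now apply vsmooth_lcross.
  assert (SK : vsmooth U V (vds T)) by now apply vsmooth_vds.
  assert (SNs : vsmooth U V (vds N)) by now apply vsmooth_vds.
  assert (SNt : vsmooth U V (vdt N)) by now apply vsmooth_vdt.
  rewrite (dt_ldot U V (vds N) B), (vsmooth_schwarz U V openU openV N) by auto.
  transitivity (ds (fun s t => ldot (vdt N s t) (B s t)) s t +
    - (1 / 2) * ds (fun s t => ldot (vds T s t) (vds T s t)) s t).
  2: { symmetry. unfold ds. rewrite Derive_plus, Derive_scal; [reflexivity | |].
       - apply (smooth_ex_ds U V (fun s t => ldot (vdt N s t) (B s t))); auto.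
         now apply smooth_ldot.
       - apply ex_derive_scal.
         apply (smooth_ex_ds U V (fun s t => ldot (vds T s t) (vds T s t))); auto.
         now apply smooth_ldot. }
  rewrite (ds_ldot U V (vdt N) B), (ds_ldot U V (vds T) (vds T)) by auto.
  destruct (moving_frame_s N s t SN HA Us Vt) as [_ [Ns Bs]].
  destruct (moving_frame_t N s t SN HA Us Vt) as [_ [Nt Bt]].
  cbv zeta in Ns, Bs, Nt, Bt. fold B in Bs, Bt. fold (B s t) in Ns, Bs, Nt, Bt.
  assert (KT := tangent_orthogonal_ds N s t SN HA Us Vt).
  assert (H := HA s t Us Vt). destruct H as [TT [NN TN]].
  destruct (flow_components N s t Us Vt TN TT) as [F1 F2]. fold (B s t) in F1, F2.
  assert (BN : ldot (B s t) (N s t) = 0) by (rewrite ldot_comm; apply ldot_lcross_r).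
  assert (TB : ldot (T s t) (B s t) = 0) by apply ldot_lcross_l.
  (* Only the T-components survive: N' has no N-component, B' no B-component. *)
  assert (C1 : ldot (vds N s t) (vdt B s t) =
    ldot (vds T s t) (N s t) * ldot (vdt T s t) (B s t)).
  { rewrite Ns, Bt, !ldot_lincomb_l, !ldot_lincomb_r.
    rewrite (ldot_comm (B s t) (T s t)), TT, TN, TB, BN. ring. }
  assert (C2 : ldot (vdt N s t) (vds B s t) =
    ldot (vdt T s t) (N s t) * ldot (vds T s t) (B s t)).
  { rewrite Nt, Bs, !ldot_lincomb_l, !ldot_lincomb_r.
    rewrite (ldot_comm (B s t) (T s t)), TT, TN, TB, BN. ring. }
  rewrite C1, C2, F1, F2, (ldot_comm (vds T s t) (vds (vds T) s t)).
  rewrite (adapted_parseval _ _ (vds (vds T) s t) (vds T s t) (HA s t Us Vt)).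
  fold (B s t). rewrite KT. field.
Qed.

(** The angle cancels the rotation speed of [N] in the direction of [s] and
    leaves exactly half of the squared curvature in the direction of [t]. *)
Lemma parallel_frame_of_angle N th :
  vsmooth U V N -> adapted_field N -> smooth U V th ->
  (forall s t, U s -> V t ->
     ds th s t = ldot (vds N s t) (lcross (T s t) (N s t)) /\
     dt th s t = ldot (vdt N s t) (lcross (T s t) (N s t))
                 + - (1 / 2) * ldot (vds T s t) (vds T s t)) ->
  let E1 := fun s t => hrot (T s t) (N s t) (th s t) in
  vsmooth U V E1 /\ adapted_field E1 /\
  forall s t, U s -> V t ->
    ldot (vds E1 s t) (lcross (T s t) (E1 s t)) = 0 /\
    ldot (vdt E1 s t) (lcross (T s t) (E1 s t)) =
      1 / 2 * ldot (vds T s t) (vds T s t).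
Proof.
  intros SN HA Sth Hth E1. split; [| split].
  - apply vsmooth_lincomb; auto using smooth_cosh, smooth_sinh, vsmooth_lcross.
  - intros s t Us Vt. now apply adapted_hrot, HA.
  - intros s t Us Vt. destruct (Hth s t Us Vt) as [Hs Ht]. split.
    + transitivity (ldot (vds N s t) (lcross (T s t) (N s t)) - ds th s t).
      * apply (rotation_speed_hrot (fun x => T x t) (fun x => N x t) (fun x => th x t)).
        -- now apply (vsmooth_differentiable_s U V).
        -- now apply (vsmooth_differentiable_s U V).
        -- now apply (smooth_ex_ds U V).
        -- apply (filter_imp U); [| now apply openU]. intros x Ux. now apply HA.
      * rewrite Hs. ring.
    + transitivity (ldot (vdt N s t) (lcross (T s t) (N s t)) - dt th s t).
      * apply (rotation_speed_hrot (fun y => T s y) (fun y => N s y) (fun y => th s y)).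
        -- now apply (vsmooth_differentiable_t U V).
        -- now apply (vsmooth_differentiable_t U V).
        -- now apply (smooth_ex_dt U V).
        -- apply (filter_imp V); [| now apply openV]. intros y Vy. now apply HA.
      * rewrite Ht. field.
Qed.

(** The rotation speeds are the only entries of the two matrices that depend on
    the choice of the frame; the others are components of [T_s] and [T_t].
    Those of [T_t] are derivatives of [k1] and [k2] because [E1] and [E2] vary
    along the curve only in the direction of [T], which is orthogonal to
    [T_s]. *)
Lemma frame_systems_of_rotation_speed E1 :
  vsmooth U V E1 -> adapted_field E1 ->
  let E2 := fun s t => lcross (T s t) (E1 s t) in
  (forall s t, U s -> V t ->
    ldot (vds E1 s t) (E2 s t) = 0 /\
    ldot (vdt E1 s t) (E2 s t) = 1 / 2 * ldot (vds T s t) (vds T s t)) ->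
  let k1 := fun s t => ldot (vds T s t) (E1 s t) in
  let k2 := fun s t => - ldot (vds T s t) (E2 s t) in
  frame_system_s U V T E1 E2 k1 k2 /\ frame_system_t U V T E1 E2 k1 k2.
Proof.
  intros S1 HA E2 speed k1 k2.
  assert (S2 : vsmooth U V E2) by now apply vsmooth_lcross.
  assert (SK : vsmooth U V (vds T)) by now apply vsmooth_vds.
  assert (FS : frame_system_s U V T E1 E2 k1 k2).
  { intros s t Us Vt. destruct (moving_frame_s E1 s t S1 HA Us Vt) as [Ts [E1s E2s]].
    cbv zeta in Ts, E1s, E2s. fold E2 in E2s. fold (E2 s t) in Ts, E1s, E2s.
    destruct (speed s t Us Vt) as [H _]. rewrite H, Ropp_0, lincomb_0_r in E1s, E2s.
    repeat split; assumption. }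
  split; [exact FS |]. intros s t Us Vt.
  destruct (FS s t Us Vt) as [Ts [E1s E2s]].
  destruct (moving_frame_t E1 s t S1 HA Us Vt) as [Tt [E1t E2t]].
  cbv zeta in Tt, E1t, E2t. fold E2 in E2t. fold (E2 s t) in Tt, E1t, E2t.
  destruct (HA s t Us Vt) as [TT [EE TE]].
  assert (KT := tangent_orthogonal_ds E1 s t S1 HA Us Vt).
  destruct (flow_components E1 s t Us Vt TE TT) as [F1 F2]. fold (E2 s t) in F1, F2.
  assert (D1 : ds k1 s t = - ldot (vdt T s t) (E2 s t)).
  { unfold k1. rewrite (ds_ldot U V (vds T) E1) by auto.
    rewrite F2, E1s, (ldot_comm _ (scal _ _)), ldot_scal_l, (ldot_comm (T s t)), KT. ring. }
  assert (D2 : ds k2 s t = ldot (vdt T s t) (E1 s t)).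
  { transitivity (- ds (fun s t => ldot (vds T s t) (E2 s t)) s t);
      [apply Derive_opp |].
    rewrite (ds_ldot U V (vds T) E2) by auto.
    rewrite F1, E2s, (ldot_comm _ (scal _ _)), ldot_scal_l, (ldot_comm (T s t)), KT. ring. }
  assert (W : - ldot (vdt E1 s t) (E2 s t) = - (1 / 2) * (k1 s t ^ 2 - k2 s t ^ 2)).
  { destruct (speed s t Us Vt) as [_ ->].
    rewrite (adapted_parseval _ _ (vds T s t) (vds T s t) (HA s t Us Vt)), KT.
    fold (E2 s t). unfold k1, k2. field. }
  rewrite <- D1, <- D2 in Tt. rewrite <- D2, W in E1t. rewrite <- D1, W in E2t.
  repeat split; assumption.
Qed.

End ParallelFrame.

(** * Consequences of the vortex filament equation *)

Lemma lcross_self x : lcross x x = zero.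
Proof.
  apply E13_eq; unfold lcross, x1, x2, x3; simpl; unfold zero; simpl; ring.
Qed.

Lemma tangent_flow U V alpha : open U -> open V ->
  vsmooth U V alpha -> vortex_filament U V alpha ->
  forall s t, U s -> V t ->
  vdt (vds alpha) s t = lcross (vds alpha s t) (vds (vds (vds alpha)) s t).
Proof.
  intros oU oV Sa vfe s t Us Vt.
  assert (ST : vsmooth U V (vds alpha)) by now apply vsmooth_vds.
  assert (SK : vsmooth U V (vds (vds alpha))) by now apply vsmooth_vds.
  rewrite (vsmooth_schwarz U V oU oV) by auto.
  rewrite (vds_ext U V oU _ _ s t vfe Us Vt).
  transitivity (plus (lcross (vds (vds alpha) s t) (vds (vds alpha) s t))
    (lcross (vds alpha s t) (vds (vds (vds alpha)) s t))).
  - apply (vderive_lcross (fun x => vds alpha x t) (fun x => vds (vds alpha) x t));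
      now apply (vsmooth_differentiable_s U V).
  - rewrite lcross_self. apply plus_zero_l.
Qed.

Lemma constant_of_null_derive a b (f : R -> R) :
  (forall x, in_oint a b x -> is_derive f x 0) ->
  forall x y, in_oint a b x -> in_oint a b y -> f x = f y.
Proof.
  intros Hf x y Hx Hy.
  destruct (MVT_gen f x y (fun _ => 0)) as [z [_ Hz]]; [| | lra].
  - intros z Hz. apply Hf. apply (in_oint_between a b x y); auto. lra.
  - intros z Hz. apply continuity_pt_filterlim.
    apply (ex_derive_continuous (V := R_NormedModule)). exists 0.
    apply Hf. now apply (in_oint_between a b x y).
Qed.

(** As [T_t = T x T_ss] is orthogonal to [T], the squared length of [T] does not
    change with time. *)
Lemma unit_tangent U c d T : open U -> in_oint c d 0 ->
  vsmooth U (in_oint c d) T ->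
  (forall s t, U s -> in_oint c d t -> vdt T s t = lcross (T s t) (vds (vds T) s t)) ->
  (forall s, U s -> 0 < ldot (T s 0) (T s 0)) ->
  (forall s, U s -> lnorm (T s 0) = 1) ->
  forall s t, U s -> in_oint c d t -> ldot (T s t) (T s t) = 1.
Proof.
  intros oU V0 ST flow pos unit s t Us Vt.
  transitivity (ldot (T s 0) (T s 0)).
  - apply (constant_of_null_derive c d (fun y => ldot (T s y) (T s y))); auto.
    intros y Vy. replace 0 with (ldot (vdt T s y) (T s y) + ldot (T s y) (vdt T s y)).
    + apply (is_derive_ldot (fun y => T s y) (fun y => T s y));
        now apply (vsmooth_differentiable_t U (in_oint c d)).
    + rewrite (ldot_comm _ (T s y)), flow, ldot_lcross_l by auto. ring.
  - specialize (pos s Us). specialize (unit s Us). unfold lnorm in unit.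
    rewrite Rabs_pos_eq in unit by lra.
    assert (H := sqrt_sqrt (ldot (T s 0) (T s 0)) ltac:(lra)). rewrite unit in H. lra.
Qed.

(** Division by the curvature normalises [T_s] without changing its causal
    character: a principal normal of squared length [1] excludes a timelike
    [T_s], which would yield [-1], and a null one, which would yield [0]. *)
Lemma curvature_pos U c s : timelike_binormal U c -> U s ->
  0 < ldot (vderive (tangent c) s) (vderive (tangent c) s).
Proof.
  intros H Us. destruct (H s Us) as [H1 _]. revert H1.
  unfold principal_normal, curvature, lnorm.
  rewrite ldot_scal_l, (ldot_comm _ (scal _ _)), ldot_scal_l.
  generalize (ldot (vderive (tangent c) s) (vderive (tangent c) s)). intros k Hk.
  destruct (Rlt_le_dec 0 k) as [| Hneg]; auto. exfalso.
  destruct (Req_dec k 0) as [-> | Hk0]; [rewrite !Rmult_0_r in Hk; lra |].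
  rewrite Rabs_left in Hk by lra.
  assert (Hp := sqrt_lt_R0 (- k) ltac:(lra)). assert (Hq := sqrt_sqrt (- k) ltac:(lra)).
  assert (/ sqrt (- k) * (/ sqrt (- k) * k) = -1); [| lra].
  replace k with (- (sqrt (- k) * sqrt (- k))) at 3 by lra. field. lra.
Qed.

Lemma adapted_normalize T K : ldot T T = 1 -> ldot K T = 0 -> 0 < ldot K K ->
  adapted T (scal (/ sqrt (ldot K K)) K).
Proof.
  intros TT KT HK. split; [exact TT |].
  rewrite (ldot_comm T), !ldot_scal_l, (ldot_comm K (scal _ _)), ldot_scal_l, KT.
  split; [| ring].
  assert (Hp := sqrt_lt_R0 _ HK). assert (Hq := sqrt_sqrt (ldot K K) ltac:(lra)).
  rewrite <- Hq at 3. field. lra.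
Qed.

Theorem theorem3p5 (a b c d : Rbar) (hab : Rbar_lt a b)
    (hc : Rbar_lt c 0) (hd : Rbar_lt 0 d)
    (alpha : R -> R -> R * R * R)
    (alpha_smooth : vsmooth (in_oint a b) (in_oint c d) alpha)
    (alpha_vfe : vortex_filament (in_oint a b) (in_oint c d) alpha)
    (alpha_curves : forall t : R, in_oint c d t ->
       spacelike_curve (in_oint a b) (fun s => alpha s t) /\
       timelike_binormal (in_oint a b) (fun s => alpha s t))
    (alpha_unit : forall s : R, in_oint a b s -> lnorm (vds alpha s 0) = 1) :
  (exists (E1 E2 : R -> R -> R * R * R) (k1 k2 : R -> R -> R),
     evolving_parallel_frame (in_oint a b) (in_oint c d) alpha E1 E2 k1 k2) /\
  (forall (E1 E2 : R -> R -> R * R * R) (k1 k2 : R -> R -> R),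
     evolving_parallel_frame (in_oint a b) (in_oint c d) alpha E1 E2 k1 k2 ->
     nonlinear_heat_system (in_oint a b) (in_oint c d)
       (fun s t => 1 / sqrt 2 * (k1 s t + k2 s t))
       (fun s t => 1 / sqrt 2 * (k1 s t - k2 s t))).
Proof.
  assert (oU := open_in_oint a b). assert (oV := open_in_oint c d).
  assert (V0 : in_oint c d 0) by (split; assumption).
  assert (hcd : Rbar_lt c d) by now apply Rbar_lt_trans with 0.
  assert (ST := vsmooth_vds _ _ alpha alpha_smooth).
  split.
  - assert (SK := vsmooth_vds _ _ _ ST).
    assert (flow := tangent_flow _ _ alpha oU oV alpha_smooth alpha_vfe).
    set (T := vds alpha) in *.
    assert (TT := unit_tangent (in_oint a b) c d T oU V0 ST flow
      (fun s => proj1 (alpha_curves 0 V0) s) alpha_unit).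
    assert (KK : forall s t, in_oint a b s -> in_oint c d t ->
      0 < ldot (vds T s t) (vds T s t)).
    { intros s t Us Vt.
      exact (curvature_pos _ _ s (proj2 (alpha_curves t Vt)) Us). }
    assert (KT : forall s t, in_oint a b s -> in_oint c d t ->
      ldot (vds T s t) (T s t) = 0).
    { intros s t Us Vt.
      assert (H : ldot (vds T s t) (T s t) + ldot (T s t) (vds T s t) = 0).
      { apply (ldot_orthogonal_derive (fun x => T x t) (fun x => T x t) s 1);
          try now apply (vsmooth_differentiable_s (in_oint a b) (in_oint c d)).
        apply (filter_imp (in_oint a b)); [| now apply oU]. intros x Ux. now apply TT. }
      rewrite (ldot_comm (T s t)) in H. lra. }
    pose (N := fun s t => scal (/ sqrt (ldot (vds T s t) (vds T s t))) (vds T s t)).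
    assert (SN : vsmooth (in_oint a b) (in_oint c d) N).
    { apply (vsmooth_scal _ _ oU oV (fun s t => / sqrt (ldot (vds T s t) (vds T s t))));
        auto. apply (smooth_inv_sqrt _ _ oU oV); auto using smooth_ldot. }
    assert (HN : adapted_field (in_oint a b) (in_oint c d) T N).
    { intros s t Us Vt. apply adapted_normalize; auto. }
    destruct (closed_form_primitive a b c d
      (fun s t => ldot (vds N s t) (lcross (T s t) (N s t)))
      (fun s t => ldot (vdt N s t) (lcross (T s t) (N s t))
                  + - (1 / 2) * ldot (vds T s t) (vds T s t)))
      as [th [Sth Hth]]; auto.
    { apply smooth_ldot; auto using vsmooth_vds, vsmooth_lcross. }
    { apply (smooth_plus _ _ oU oV (fun s t => ldot (vdt N s t) (lcross (T s t) (N s t)))).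
      - apply smooth_ldot; auto using vsmooth_vdt, vsmooth_lcross.
      - apply (smooth_mult _ _ oU oV (fun _ _ => - (1 / 2)));
          auto using smooth_const, smooth_ldot. }
    { exact (rotation_form_closed _ _ oU oV T ST flow N SN HN). }
    destruct (parallel_frame_of_angle _ _ oU oV T ST N th SN HN Sth Hth)
      as [S1 [HA speed]].
    set (E1 := fun s t => hrot (T s t) (N s t) (th s t)) in *.
    destruct (frame_systems_of_rotation_speed _ _ oU oV T ST flow E1 S1 HA speed)
      as [FS FT].
    assert (S2 : vsmooth (in_oint a b) (in_oint c d) (fun s t => lcross (T s t) (E1 s t)))
      by now apply vsmooth_lcross.
    do 4 eexists. split; [exact S1 |]. split; [exact S2 |].
    split; [| split; [| split; [| split; [exact FS | exact FT]]]].
    + now apply smooth_ldot.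
    + apply smooth_opp; auto. now apply smooth_ldot.
    + intros t Vt. split.
      * intros s Us. destruct (HA s t Us Vt) as [HT [HE HTE]].
        destruct (FS s t Us Vt) as [_ [E1s E2s]].
        change (tangent (fun s => alpha s t) s) with (T s t).
        change (vderive (fun s => E1 s t) s) with (vds E1 s t).
        change (vderive (fun s => lcross (T s t) (E1 s t)) s)
          with (vds (fun s t => lcross (T s t) (E1 s t)) s t).
        rewrite E1s, E2s, (ldot_comm (E1 s t) (scal _ _)), !ldot_scal_l, HTE,
          ldot_lcross_l, ldot_lcross_r, !Rmult_0_r.
        assert (BB := adapted_lcross _ _ (HA s t Us Vt)). now repeat split.
      * intros s Us. apply (FS s t Us Vt).
  - intros E1 E2 k1 k2 [S1 [S2 [Sk1 [Sk2 [frame [FS FT]]]]]].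
    apply heat_system_of_principal_curvatures; auto.
    intros s t Us Vt.
    apply (frame_compatibility (in_oint a b) (in_oint c d) oU oV (vds alpha) E1 E2); auto.
    intros u v Uu Vv. destruct (frame v Vv) as [orth _].
    destruct (orth u Uu) as [TT [EE [BB [TE [TB [EB _]]]]]].
    repeat split; assumption.
Qed.
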